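(* Let $m,n\ge 1$ be integers, let $\xi^1,\dots,\xi^m$ be particles in a set $\mathsf{X}$ with weights $\omega^1,\dots,\omega^m\ge 0$, $\sum_{i=1}^m\omega^i=1$, and let $f:\mathsf{X}\to\mathbb{R}$ be a function. Let $\tilde\xi_{\mathrm{strat}}^1,\dots,\tilde\xi_{\mathrm{strat}}^n$ be obtained by stratified resampling and $\tilde\xi_{\mathrm{mult}}^1,\dots,\tilde\xi_{\mathrm{mult}}^n$ by multinomial resampling from the same weighted particles. Then the conditional variance of stratified resampling never exceeds that of multinomial resampling: $$\operatorname{Var}\Big[\tfrac1n\sum_{i=1}^n f(\tilde\xi_{\mathrm{strat}}^i)\,\Big|\,\mathcal{G}\Big]\;\le\;\operatorname{Var}\Big[\tfrac1n\sum_{i=1}^n f(\tilde\xi_{\mathrm{mult}}^i)\,\Big|\,\mathcal{G}\Big].$$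
   Context: $\mathcal{G}$ denotes the $\sigma$-field with respect to which the particles $\xi^i$ and normalized weights $\omega^i$ are measurable; conditionally on $\mathcal{G}$ they are fixed and the only randomness is that of the resampling. For $u\in(0,1]$ let $D_\omega^{\mathrm{inv}}(u)=i$ if $u\in(\sum_{j=1}^{i-1}\omega^j,\sum_{j=1}^{i}\omega^j]$. Multinomial resampling: $\tilde\xi^i=\xi^{I^i}$ with $I^i=D_\omega^{\mathrm{inv}}(U^i)$, where $U^1,\dots,U^n$ are i.i.d. uniform on $(0,1]$ and independent of $\mathcal{G}$. Stratified resampling: $\tilde\xi^i=\xi^{I^i}$ with $I^i=D_\omega^{\mathrm{inv}}(U^i)$, where $U^1,\dots,U^n$ are independent, independent of $\mathcal{G}$, and $U^i$ is uniform on $((i-1)/n,\,i/n]$. *)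

(* Defs.v *)
From HB Require Import structures.
From mathcomp Require Import all_boot all_order all_algebra.
From mathcomp Require Import all_classical all_reals all_analysis.

Set Implicit Arguments.
Unset Strict Implicit.
Unset Printing Implicit Defensive.

Import Order.TTheory GRing.Theory Num.Theory.
Import numFieldNormedType.Exports.

Local Open Scope classical_set_scope.
Local Open Scope ring_scope.

Section ConditionalVariance.
Context {d : measure_display} {T : measurableType d} {R : realType}.
Variables (P : probability T R) (G : set (set T)).

Definition is_sub_sigma_field := sigma_algebra setT G /\ G `<=` measurable.

(* When G is a sigma-algebra, the measurable sets of g_sigma_algebraType G are
   exactly the elements of G. *)
Definition measurable_wrt (g : T -> R) : Prop :=
  measurable_fun setT (g : g_sigma_algebraType G -> R).

(* Z is a version of E[Y | G]. For integrable Y this is the usual definition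
   (take F constantly equal to setT). The first clause only asks Y to be
   sigma-integrable relative to G, so that E[h(theta, U) | G] makes sense for
   any G-measurable theta and U independent of G as soon as h(x, U) is
   integrable for each frozen x; no moment of theta is required. Versions are
   still unique up to P-null sets. *)
Definition is_cond_exp (Y Z : T -> R) : Prop :=
  [/\ exists F : (set T)^nat,
        [/\ forall k, G (F k), \bigcup_k F k = setT
          & forall k, P.-integrable (F k) (EFin \o Y)],
      measurable_wrt Z
    & forall A, G A -> P.-integrable A (EFin \o Y) ->
        P.-integrable A (EFin \o Z) /\
        (\int[P]_(x in A) (Z x)%:E = \int[P]_(x in A) (Y x)%:E)%E].

(* A chosen version of E[Y | G], and 0 if there is none. *)
Definition cond_exp (Y : T -> R) : T -> R :=
  xget (cst 0) [set Z | is_cond_exp Y Z].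

Definition cond_var (Y : T -> R) : T -> R :=
  cond_exp (fun x => (Y x - cond_exp Y x) ^+ 2).

(* U^1, ..., U^n are mutually independent and jointly independent of G.
   Taking some of the B i equal to setT gives the product rule for every
   subfamily. *)
Definition indep_with (n : nat) (U : 'I_n -> {RV P >-> R}) : Prop :=
  forall (A : set T) (B : 'I_n -> set R),
    G A -> (forall i, measurable (B i)) ->
    (P (A `&` \bigcap_(i in [set: 'I_n]) (U i @^-1` B i)) =
     P A * \prod_(i < n) P (U i @^-1` B i))%E.

(* uniform_prob has density 1 / (b - a) on [a, b]; endpoints are null, so it is
   also the uniform law on ]a, b]. *)
Definition uniform_on (a b : R) (U : {RV P >-> R}) : Prop :=
  exists ab : a < b,
    forall B, measurable B -> distribution P U B = uniform_prob ab B.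

Definition multinomial_uniforms (n : nat) (U : 'I_n -> {RV P >-> R}) : Prop :=
  indep_with U /\ forall i, uniform_on 0 1 (U i).

(* The index i ranges over 0, ..., n-1. *)
Definition stratified_uniforms (n : nat) (U : 'I_n -> {RV P >-> R}) : Prop :=
  indep_with U /\
  forall i : 'I_n, uniform_on (i%:R / n%:R) (i.+1%:R / n%:R) (U i).

End ConditionalVariance.

Section Resampling.
Context {R : realType} {T X : Type}.
Variables (m : nat) (m_gt0 : (0 < m)%N).

(* For weights w >= 0 of sum 1 and u in ]0, 1], exactly one i satisfies the
   test; outside ]0, 1] none does and the value is the first index. *)
Definition Dinv (w : 'I_m -> R) (u : R) : 'I_m :=
  odflt (Ordinal m_gt0)
    [pick i : 'I_m | \sum_(j < m | (j < i)%N) w j < u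
                       <= \sum_(j < m | (j <= i)%N) w j].

Definition resample (n : nat) (xi : 'I_m -> T -> X) (w : 'I_m -> T -> R)
    (U : 'I_n -> T -> R) (i : 'I_n) (t : T) : X :=
  xi (Dinv (w^~ t) (U i t)) t.

Definition sample_mean (n : nat) (f : X -> R) (xs : 'I_n -> T -> X) (t : T) : R :=
  n%:R^-1 * \sum_(i < n) f (xs i t).

End Resampling.

(* Main.v *)
(** Conditionally on [G], every sample index is a finite-valued function of the
    uniforms, with conditional law given by increments of uniform distribution
    functions between the partial sums of the weights. For [G]-measurable partial
    sums this law is obtained by rounding them up to a grid, where independence
    applies directly, and letting the mesh tend to 0. Both conditional variances
    are then sums of one-sample variances under product laws. The stratified laws
    average to the weights, so the second moments agree and the inequality
    reduces to Jensen's inequality for the squared means of the strata. *)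
Require Import Defs.
From HB Require Import structures.
From mathcomp Require Import all_boot all_order all_algebra.
From mathcomp Require Import all_classical all_reals all_analysis.
From mathcomp Require Import measurable_realfun.
From mathcomp Require Import ring lra.

Set Implicit Arguments.
Unset Strict Implicit.
Unset Printing Implicit Defensive.

Import Order.TTheory GRing.Theory Num.Theory.
Import numFieldNormedType.Exports.

Local Open Scope classical_set_scope.
Local Open Scope ring_scope.

(** * Product weights on a finite set *)

(** Independence under the product law: the sum over [s] factors coordinatewise, and every
    coordinate other than [k] and [l] contributes total mass 1. *)
Lemma sum_prod_weights_mul2 (R : comPzRingType) (n : nat) (S : finType)
    (p x : 'I_n -> S -> R) (k l : 'I_n) :
  (forall j, \sum_i p j i = 1) ->
  \sum_(s : {ffun 'I_n -> S}) (\prod_j p j (s j)) * (x k (s k) * x l (s l)) =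
  if k == l then \sum_i p k i * x k i ^+ 2
  else (\sum_i p k i * x k i) * (\sum_i p l i * x l i).
Proof.
move=> p1.
(* Padding with 1 off coordinate [r] turns each factor into a product over all coordinates, so that
   the sum of products becomes a product of sums. *)
pose y (r j : 'I_n) i := if j == r then x j i else 1.
have yE r (s : {ffun 'I_n -> S}) : \prod_j y r j (s j) = x r (s r).
  by rewrite (bigD1 r)//= /y eqxx big1 ?mulr1// => j /negPf ->.
under eq_bigr => s _ do rewrite -(yE k) -(yE l) -!big_split/=.
rewrite -(bigA_distr_bigA (fun j i => p j i * (y k j i * y l j i)))/=.
have [<-|kl] := eqVneq k l.
  rewrite (bigD1 k)//= [X in _ * X]big1 => [|j jk].
    by rewrite mulr1; apply: eq_bigr => i _; rewrite /y eqxx expr2.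
  by rewrite -(p1 j); apply: eq_bigr => i _; rewrite /y (negPf jk) !mulr1.
rewrite (bigD1 k)//= (bigD1 l)/=; last by rewrite eq_sym.
rewrite [X in _ * (_ * X)]big1 => [|j /andP[jk jl]].
  rewrite mulr1; congr (_ * _); apply: eq_bigr => i _.
    by rewrite /y eqxx (negPf kl) mulr1.
  by rewrite /y eqxx eq_sym (negPf kl) mul1r.
by rewrite -(p1 j); apply: eq_bigr => i _; rewrite /y (negPf jk) (negPf jl) !mulr1.
Qed.

Lemma mean_sum_prod_weights (R : comPzRingType) (n : nat) (S : finType)
    (p x : 'I_n -> S -> R) :
  (forall j, \sum_i p j i = 1) ->
  \sum_(s : {ffun 'I_n -> S}) (\prod_j p j (s j)) * \sum_k x k (s k) =
  \sum_k \sum_i p k i * x k i.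
Proof.
move=> p1; under eq_bigr do rewrite mulr_sumr.
rewrite exchange_big/=; apply: eq_bigr => k _.
pose y j i := if j == k then x k i else 1.
rewrite (eq_bigr (fun s : {ffun 'I_n -> S} => \prod_j (p j (s j) * y j (s j)))).
  rewrite -(bigA_distr_bigA (fun j i => p j i * y j i))/= (bigD1 k)//=.
  rewrite [X in _ * X]big1 => [|j jk].
    by rewrite mulr1; apply: eq_bigr => i _; rewrite /y eqxx.
  by rewrite -(p1 j); apply: eq_bigr => i _; rewrite /y (negPf jk) mulr1.
move=> s _; rewrite big_split/=; congr (_ * _).
by rewrite (bigD1 k)//= /y eqxx big1 ?mulr1// => j /negPf ->.
Qed.

(** Once each coordinate is centred at its mean, the cross terms of the expanded square factor into
    zero means and only the diagonal survives. *)
Lemma variance_sum_prod_weights (R : comPzRingType) (n : nat) (S : finType)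
    (p x : 'I_n -> S -> R) :
  (forall j, \sum_i p j i = 1) ->
  \sum_(s : {ffun 'I_n -> S}) (\prod_j p j (s j)) *
     (\sum_k x k (s k) - \sum_k \sum_i p k i * x k i) ^+ 2 =
  \sum_k (\sum_i p k i * x k i ^+ 2 - (\sum_i p k i * x k i) ^+ 2).
Proof.
move=> p1.
pose mu k := \sum_i p k i * x k i.
pose y k i := x k i - mu k.
have y0 k : \sum_i p k i * y k i = 0.
  rewrite /y; under eq_bigr do rewrite mulrBr.
  by rewrite sumrB -mulr_suml p1 mul1r subrr.
transitivity (\sum_k \sum_l \sum_(s : {ffun 'I_n -> S})
    (\prod_j p j (s j)) * (y k (s k) * y l (s l))).
  under [RHS]eq_bigr do rewrite exchange_big/=.
  rewrite [RHS]exchange_big/=; apply: eq_bigr => s _.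
  rewrite -sumrB -/(mu _) expr2 mulr_suml mulr_sumr; apply: eq_bigr => k _.
  by rewrite mulr_sumr mulr_sumr.
apply: eq_bigr => k _; rewrite (bigD1 k)//= [X in _ + X]big1 ?addr0 => [|l lk].
  rewrite sum_prod_weights_mul2// eqxx -/(mu k).
  rewrite (eq_bigr (fun i => p k i * x k i ^+ 2 - (p k i * x k i * (2 * mu k) -
      p k i * mu k ^+ 2))) => [|i _].
    rewrite sumrB; congr (_ - _).
    by rewrite sumrB -!mulr_suml p1 -/(mu k); ring.
  by rewrite /y; ring.
by rewrite sum_prod_weights_mul2// eq_sym (negPf lk) !y0 mul0r.
Qed.

(** Lagrange's identity: the sum of all squared differences [mu k - mu l] is twice the gap between
    the two sides. *)
Lemma sqr_sum_le (R : realDomainType) (n : nat) (mu : 'I_n -> R) :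
  (\sum_k mu k) ^+ 2 <= n%:R * \sum_k mu k ^+ 2.
Proof.
have : 0 <= \sum_k \sum_l (mu k - mu l) ^+ 2.
  by apply: sumr_ge0 => k _; apply: sumr_ge0 => l _; rewrite sqr_ge0.
rewrite (_ : \sum_k _ = 2 * (n%:R * \sum_k mu k ^+ 2 - (\sum_k mu k) ^+ 2)).
  by rewrite pmulr_rge0// subr_ge0.
rewrite (eq_bigr (fun k => n%:R * mu k ^+ 2 + \sum_l mu l ^+ 2
    - 2 * (mu k * \sum_l mu l))) => [|k _].
  rewrite sumrB big_split/= -!mulr_sumr -mulr_suml sumr_const card_ord.
  by rewrite -[_ *+ n]mulr_natl; ring.
rewrite (eq_bigr (fun l => mu k ^+ 2 + mu l ^+ 2 - 2 * (mu k * mu l))).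
  rewrite sumrB big_split/= -!mulr_sumr sumr_const card_ord.
  by rewrite -[mu k *+ n]mulr_natl; ring.
by move=> l _; ring.
Qed.

(* Averaging the laws p k to w leaves the second moment unchanged, so the
   comparison reduces to Jensen's inequality for the n conditional means. *)
Lemma le_variance_averaged_weights (R : realFieldType) (n : nat) (S : finType)
    (p : 'I_n -> S -> R) (w x : S -> R) :
  (0 < n)%N -> (forall i, \sum_k p k i = n%:R * w i) ->
  \sum_(k < n) (\sum_i p k i * x i ^+ 2 - (\sum_i p k i * x i) ^+ 2) <=
  \sum_(k < n) (\sum_i w i * x i ^+ 2 - (\sum_i w i * x i) ^+ 2).
Proof.
move=> n0 pw.
have avg (y : S -> R) : \sum_(k < n) \sum_i p k i * y i = n%:R * \sum_i w i * y i.
  rewrite exchange_big mulr_sumr; apply: eq_bigr => i _.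
  by rewrite -mulr_suml pw mulrA.
rewrite sumrB avg [leRHS]sumr_const card_ord -[leRHS]mulr_natl mulrBr lerB//.
have := @sqr_sum_le _ n (fun k => \sum_i p k i * x i).
by rewrite avg exprMn expr2 -mulrA ler_pM2l ?ltr0n.
Qed.

(** * Conditional expectation of a finite mixture *)

Section density.
Import HBNNSimple.

(** The set identity for [nu] settles indicators, linearity simple functions, and monotone
    convergence along [nnsfun_approx] the general case. *)
Lemma ge0_integral_density d (T : measurableType d) (R : realType)
    (nu mu : {measure set T -> \bar R}) (q f : T -> R) (A : set T) :
  measurable_fun setT q -> (forall x, 0 <= q x) ->
  (forall B, measurable B -> nu B = \int[mu]_(x in B) (q x)%:E)%E ->
  measurable_fun setT f -> (forall x, 0 <= f x) -> measurable A ->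
  (\int[nu]_(x in A) (f x)%:E = \int[mu]_(x in A) (f x * q x)%:E)%E.
Proof.
move=> mq q0 nuq mf f0 mA.
have mq' B : measurable_fun B (fun x => (q x)%:E).
  by apply/measurable_EFinP; exact: measurable_funTS.
have mEf : measurable_fun A (fun x => (f x)%:E).
  by apply/measurable_EFinP; exact: measurable_funTS.
pose h := nnsfun_approx mA mEf.
have simple n : (\int[nu]_(x in A) (h n x)%:E =
                 \int[mu]_(x in A) (h n x * q x)%:E)%E.
  under [LHS]eq_integral do rewrite fimfunE -fsumEFin//.
  rewrite [LHS]ge0_integral_fsum//; last 2 first.
  - by move=> r; exact/measurable_EFinP/measurableT_comp.
  - by move=> r x _; rewrite EFinM nnfun_muleindic_ge0.
  under [RHS]eq_integral do rewrite fimfunE mulrC mulr_fsumr// -fsumEFin//.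
  rewrite [RHS]ge0_integral_fsum//; last 2 first.
  - move=> r; apply/measurable_EFinP; apply: measurable_funM.
      exact: measurable_funTS.
    exact: measurableT_comp.
  - move=> r x _; rewrite EFinM mule_ge0//; first by rewrite lee_fin.
    by rewrite EFinM; exact: nnfun_muleindic_ge0.
  apply: eq_fsbigr => r _.
  rewrite integralZl_indic_nnsfun// integral_indic// nuq; last exact: measurableI.
  have [r0|r0] := ltP r 0.
    rewrite preimage_nnfun0// set0I integral_set0 mule0 integral0_eq// => x _.
    by rewrite indic0 !mulr0.
  rewrite -ge0_integralZl//; last 2 first.
  - exact: measurableI.
  - by move=> x _; rewrite lee_fin.
  rewrite [RHS](_ : _ = \int[mu]_(x in A)
      (((fun x => (r * q x)%:E) \_ (h n @^-1` [set r])) x))%E; last first.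
    apply: eq_integral => x _; rewrite patchE indicE; case: ifPn => _.
      by rewrite mulr1 mulrC.
    by rewrite !mulr0.
  by rewrite -integral_mkcondr setIC.
have cv x : A x -> (h n x)%:E @[n --> \oo] --> (f x)%:E.
  by move=> Ax; apply: (cvg_nnsfun_approx mA mEf) => // y _; rewrite lee_fin.
transitivity (limn (fun n => \int[nu]_(x in A) (h n x)%:E)%E).
  rewrite -monotone_convergence//.
  - by apply: eq_integral => x /[!inE] Ax; apply/esym/cvg_lim => //; exact: cv.
  - by move=> n; apply/measurable_EFinP; exact: measurable_funTS.
  - by move=> n x _; rewrite lee_fin.
  - by move=> x _ m n mn; rewrite lee_fin; exact/lefP/nd_nnsfun_approx.
rewrite (funext simple) -monotone_convergence//.
- apply: eq_integral => x /[!inE] Ax; apply/cvg_lim => //.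
  under eq_fun do rewrite EFinM.
  by rewrite EFinM; apply: cvgeZr => //; exact: cv.
- move=> n; apply/measurable_EFinP; apply: measurable_funTS.
  exact: measurable_funM.
- by move=> n x _; rewrite lee_fin mulr_ge0.
- move=> x _ m n mn; rewrite lee_fin ler_wpM2r//.
  exact/lefP/nd_nnsfun_approx.
Qed.

End density.

(** * Uniqueness of conditional expectations and integration against conditional probabilities *)

Section cond_exp_theory.
Context d (T : measurableType d) (R : realType) (P : probability T R).
Context (G : set (set T)) (hG : is_sub_sigma_field G).

Lemma sub_sigma_fieldE : (measurable : set (set (g_sigma_algebraType G))) = G.
Proof. exact: sigma_algebra_id hG.1. Qed.

Lemma sub_sigma_field_measurable (A : set T) : G A -> measurable A.
Proof. exact: hG.2. Qed.

Lemma measurable_id_sub_sigma_field :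
  measurable_fun setT (id : T -> g_sigma_algebraType G).
Proof.
by move=> _ B; rewrite sub_sigma_fieldE => GB; rewrite setTI; exact: hG.2.
Qed.

Lemma measurable_wrtW (g : T -> R) : measurable_wrt G g -> measurable_fun setT g.
Proof.
by move=> mg; exact: (measurableT_comp mg measurable_id_sub_sigma_field).
Qed.

(* A measure on [T] restricted to [G], as a measure on [g_sigma_algebraType G]. *)
Local Notation image_measure mu :=
  (measure_function_pushforward__canonical__measure_function_Measure
     mu measurable_id_sub_sigma_field).

Let PG : {measure set (g_sigma_algebraType G) -> \bar R} := image_measure P.

(** On each [F k] of an exhaustion making [Y] integrable, both versions have the same integral over
    every subset in [G]; they agree there almost everywhere, and countably many null sets are
    discarded. *)
Lemma cond_exp_unique (Y Z Z' : T -> R) :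
  is_cond_exp P G Y Z -> is_cond_exp P G Y Z' -> {ae P, forall t, Z t = Z' t}.
Proof.
move=> [[F [GF FT Fi]] mZ ZY] [_ mZ' Z'Y].
(* Integrals of [G]-measurable functions over sets of [G] are unchanged on the space carrying [G] as
   its full sigma-algebra, where equal integrals over all measurable sets force equality. *)
have intPG A (g : T -> R) : G A -> measurable_wrt G g ->
    P.-integrable A (EFin \o g) ->
  PG.-integrable A (EFin \o g) /\
    (\int[PG]_(x in A) (EFin \o g) x = \int[P]_(x in A) (EFin \o g) x)%E.
  move=> GA mg ig.
  have mA : measurable (A : set (g_sigma_algebraType G)) by rewrite sub_sigma_fieldE.
  have mEg : measurable_fun setT ((EFin \o g) : g_sigma_algebraType G -> \bar R).
    exact/measurable_EFinP.
  split; first exact: (integrable_pushforward measurable_id_sub_sigma_field).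
  exact: (integral_pushforward measurable_id_sub_sigma_field).
have : {ae P, forall t, forall k, F k t -> Z t = Z' t}.
  apply: ae_foralln => k.
  have intF (E : set T) : E `<=` F k -> G E ->
      P.-integrable E (EFin \o Y).
    move=> EF GE; apply: integrableS (Fi k) => //.
      exact: sub_sigma_field_measurable.
    exact: sub_sigma_field_measurable.
  have [iZ _] := ZY _ (GF k) (Fi k).
  have mFk : measurable (F k : set (g_sigma_algebraType G)).
    by rewrite sub_sigma_fieldE.
  have : ae_eq PG (F k) (EFin \o Z) (EFin \o Z').
    apply: integral_ae_eq => //.
    - exact: (intPG _ _ (GF k) mZ iZ).1.
    - by apply/measurable_EFinP; exact: measurable_funTS.
    move=> E EF; rewrite sub_sigma_fieldE => GE.
    have [iZE ZE] := ZY _ GE (intF _ EF GE).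
    have [iZ'E Z'E] := Z'Y _ GE (intF _ EF GE).
    rewrite (intPG _ _ GE mZ iZE).2 (intPG _ _ GE mZ' iZ'E).2.
    by rewrite [LHS]ZE [RHS]Z'E.
  move=> [N [mN N0 subN]]; exists N; split => //.
    by move: mN; rewrite sub_sigma_fieldE; exact: sub_sigma_field_measurable.
  by move=> t /= ZZ'; apply: subN => /= h; apply: ZZ' => /h [].
apply: filterS => t Ft; have : setT t by []; rewrite -FT => -[k _]; exact: Ft.
Qed.

(** Here [q] is a version of the conditional probability of [E], a density only as far as sets of
    [G] can tell. The density lemma is therefore used twice: with [\1_E] on [T], and with [q] on the
    space carrying [G]. *)
Lemma ge0_integral_density_wrt (E A : set T) (q g : T -> R) :
  measurable E -> measurable_wrt G q -> (forall x, 0 <= q x) ->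
  (forall B, G B -> P (B `&` E) = \int[P]_(x in B) (q x)%:E)%E ->
  measurable_wrt G g -> (forall x, 0 <= g x) -> G A ->
  (\int[P]_(x in A) (g x * \1_E x)%:E = \int[P]_(x in A) (g x * q x)%:E)%E.
Proof.
move=> mE mq q0 PE mg g0 GA.
have mA := sub_sigma_field_measurable GA.
have mA' : measurable (A : set (g_sigma_algebraType G)) by rewrite sub_sigma_fieldE.
pose nu : {measure set (g_sigma_algebraType G) -> \bar R} :=
  image_measure (mrestr P mE).
rewrite -(@ge0_integral_density _ _ _ (mrestr P mE) P)//; last 2 first.
  by move=> B mB; rewrite integral_indic// setIC.
  exact: measurable_wrtW.
transitivity (\int[nu]_(x in A) (g x)%:E)%E.
  rewrite (ge0_integral_pushforward measurable_id_sub_sigma_field)//.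
    by apply/measurable_EFinP; exact: measurable_funTS.
  by move=> x _; rewrite lee_fin.
rewrite (@ge0_integral_density _ _ _ nu PG q)//.
  rewrite (ge0_integral_pushforward measurable_id_sub_sigma_field)//.
    by apply/measurable_EFinP; apply: measurable_funTS; exact: measurable_funM.
  by move=> x _; rewrite lee_fin mulr_ge0.
move=> B; rewrite sub_sigma_fieldE => GB.
rewrite (ge0_integral_pushforward measurable_id_sub_sigma_field)//.
- by rewrite -PE.
- by rewrite sub_sigma_fieldE.
- by apply/measurable_EFinP; exact: measurable_funTS.
- by move=> x _; rewrite lee_fin.
Qed.

(** * Finite mixtures selected by an index with conditional law [q] given [G] *)

Section finite_mixture.
Context (S : finType) (J : T -> S) (q : S -> T -> R).
Hypothesis mJ : forall s, measurable (J @^-1` [set s]).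
Hypothesis mq : forall s, measurable_wrt G (q s).
Hypothesis q0 : forall s x, 0 <= q s x.
Hypothesis PJ : forall s A, G A ->
  (P (A `&` J @^-1` [set s]) = \int[P]_(x in A) (q s x)%:E)%E.

Lemma mixture_indicE (h : S -> T -> R) (x : T) :
  h (J x) x = \sum_s h s x * \1_(J @^-1` [set s]) x.
Proof.
rewrite (bigD1 (J x))//= big1 ?addr0 => [|s sJ].
  by rewrite indicE mem_set// mulr1.
rewrite indicE memNset ?mulr0//= => Js.
by move: sJ; rewrite Js eqxx.
Qed.

Lemma measurable_mixture (h : S -> T -> R) :
  (forall s, measurable_fun setT (h s)) ->
  measurable_fun setT (fun x => h (J x) x).
Proof.
move=> mh; under eq_fun do rewrite mixture_indicE.
by apply: measurable_sum => s; exact: measurable_funM.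
Qed.

Lemma measurable_wrt_mixture (h : S -> T -> R) :
  (forall s, measurable_wrt G (h s)) ->
  measurable_wrt G (fun x => \sum_s h s x * q s x).
Proof.
move=> mh; apply: measurable_sum => s.
by apply: measurable_funM; [exact: mh|exact: mq].
Qed.

Lemma ge0_integral_mixture (h : S -> T -> R) (A : set T) :
  (forall s, measurable_wrt G (h s)) -> (forall s x, 0 <= h s x) -> G A ->
  (\int[P]_(x in A) (h (J x) x)%:E =
   \int[P]_(x in A) (\sum_s h s x * q s x)%:E)%E.
Proof.
move=> mh h0 GA; have mA := sub_sigma_field_measurable GA.
under eq_integral do rewrite mixture_indicE -sumEFin.
under [RHS]eq_integral do rewrite -sumEFin.
rewrite !ge0_integral_sum//.
- by apply: eq_bigr => s _; apply: ge0_integral_density_wrt => // B; exact: PJ.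
- move=> s; apply/measurable_EFinP; apply: measurable_funTS.
  by apply: measurable_funM; exact: measurable_wrtW.
- by move=> s x _; rewrite lee_fin mulr_ge0.
- move=> s; apply/measurable_EFinP; apply: measurable_funTS.
  by apply: measurable_funM => //; exact: measurable_wrtW.
- by move=> s x _; rewrite lee_fin mulr_ge0.
Qed.

(** The nonnegative identity is applied to the positive and negative parts of [h], whose mixtures
    are both integrable wherever the mixture of [h] is. *)
Lemma is_cond_exp_mixture (h : S -> T -> R) :
  (forall s, measurable_wrt G (h s)) ->
  is_cond_exp P G (fun x => h (J x) x) (fun x => \sum_s h s x * q s x).
Proof.
move=> mh.
have mY : measurable_fun setT (fun x => h (J x) x).
  by apply: measurable_mixture => s; exact: measurable_wrtW.
split.
- have GF (k : nat) : G [set x | \sum_s `|h s x| <= k%:R].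
    rewrite -sub_sigma_fieldE -[X in measurable X]setTI.
    apply: (@measurable_fun_ler _ _ _ _ _ (fun=> k%:R)) => //.
    by apply: measurable_sum => s; apply: measurableT_comp => //; exact: mh.
  exists (fun k => [set x | \sum_s `|h s x| <= k%:R]); split => //.
    apply/seteqP; split => // x _.
    exists (Num.truncn (\sum_s `|h s x|)).+1 => //=.
    exact/ltW/truncnS_gt.
  move=> k; have mF := sub_sigma_field_measurable (GF k).
  apply: measurable_bounded_integrable => //.
  + by rewrite (le_lt_trans (probability_le1 _ _))// ?ltry.
  + exact: measurable_funTS.
  + exists k%:R; split; first exact: num_real.
    move=> M kM x /= hk; apply: (le_trans _ (le_trans hk (ltW kM))).
    by rewrite (bigD1 (J x))//= lerDl sumr_ge0.
- exact: measurable_wrt_mixture.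
move=> A GA iY; have mA := sub_sigma_field_measurable GA.
pose hp s x := Num.max (h s x) 0.
pose hn s x := Num.max (- h s x) 0.
have mhp s : measurable_wrt G (hp s).
  by apply: measurable_maxr => //; exact: mh.
have mhn s : measurable_wrt G (hn s).
  apply: measurable_maxr => //; apply: measurableT_comp => //; exact: mh.
have hp0 s x : 0 <= hp s x by rewrite le_max lexx orbT.
have hn0 s x : 0 <= hn s x by rewrite le_max lexx orbT.
have hE s x : h s x = hp s x - hn s x.
  rewrite /hp /hn; case: (leP (h s x) 0) => h0.
    by rewrite max_l ?oppr_ge0// sub0r opprK.
  by rewrite max_r ?subr0// oppr_le0 ltW.
have hnorm s x : hp s x + hn s x = `|h s x|.
  rewrite /hp /hn; case: (leP (h s x) 0) => h0.
    by rewrite max_l ?oppr_ge0// add0r ler0_norm.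
  by rewrite max_r ?addr0 ?gtr0_norm// oppr_le0 ltW.
have hp_le s x : hp s x <= `|h s x| by rewrite -hnorm lerDl.
have hn_le s x : hn s x <= `|h s x| by rewrite -hnorm lerDr.
(* Domination by [h] makes the mixture of [g] integrable on [A]; equality of the nonnegative
   integrals then carries finiteness over to the weighted sum. *)
have part (g : S -> T -> R) : (forall s, measurable_wrt G (g s)) ->
    (forall s x, 0 <= g s x) -> (forall s x, g s x <= `|h s x|) ->
    [/\ P.-integrable A (fun x => (g (J x) x)%:E),
       P.-integrable A (fun x => (\sum_s g s x * q s x)%:E) &
       (\int[P]_(x in A) (g (J x) x)%:E =
        \int[P]_(x in A) (\sum_s g s x * q s x)%:E)%E].
  move=> mg g0 gh.
  have int := ge0_integral_mixture mg g0 GA.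
  have ig : P.-integrable A (fun x => (g (J x) x)%:E).
    apply: le_integrable iY => //.
      apply/measurable_EFinP; apply: measurable_funTS.
      by apply: measurable_mixture => s; exact: measurable_wrtW.
    by move=> x _ /=; rewrite lee_fin ger0_norm.
  split => //; apply/integrableP; split.
    apply/measurable_EFinP; apply: measurable_funTS.
    by apply: measurable_wrtW; exact: measurable_wrt_mixture.
  under eq_integral.
    move=> x _; rewrite gee0_abs; last first.
      by rewrite lee_fin sumr_ge0// => s _; rewrite mulr_ge0.
    over.
  rewrite -int; move/integrableP : ig => [_]; apply: le_lt_trans.
  rewrite le_eqVlt; apply/orP; left; apply/eqP; apply: eq_integral => x _.
  by rewrite gee0_abs ?lee_fin.
have [ip iqp intp] := part hp mhp hp0 hp_le.
have [in_ iqn intn] := part hn mhn hn0 hn_le.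
have YE x : (h (J x) x)%:E = ((hp (J x) x)%:E - (hn (J x) x)%:E)%E.
  by rewrite hE EFinB.
have ZE x : (\sum_s h s x * q s x)%:E =
    ((\sum_s hp s x * q s x)%:E - (\sum_s hn s x * q s x)%:E)%E.
  rewrite -EFinB -sumrB; congr (_%:E); apply: eq_bigr => s _.
  by rewrite hE mulrBl.
split.
  apply: eq_integrable (integrableB mA iqp iqn) => // x _.
  exact/esym/ZE.
under eq_integral do rewrite ZE.
under [RHS]eq_integral do rewrite YE.
by rewrite !integralB// intp intn.
Qed.

(** The chosen version [Z] of the mean is [G]-measurable, so the squared deviation is again a
    mixture with [G]-measurable components; the previous lemma applies a second time. *)
Lemma cond_var_mixture (h : S -> T -> R) :
  (forall s, measurable_wrt G (h s)) ->
  {ae P, forall t, cond_var P G (fun x => h (J x) x) t =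
    \sum_s (h s t - \sum_r h r t * q r t) ^+ 2 * q s t}.
Proof.
move=> mh; have ceY := is_cond_exp_mixture mh.
set Y := fun x => h (J x) x; pose Z := cond_exp P G Y.
(* The explicit version shows that [xget] does not fall back on its default 0. *)
have ceZ : is_cond_exp P G Y Z by apply: xgetPex; eexists; exact: ceY.
pose h2 s x := (h s x - Z x) ^+ 2.
have mh2 s : measurable_wrt G (h2 s).
  apply: measurable_funX; apply: measurable_funB; first exact: mh.
  by case: ceZ.
have ceY2 := is_cond_exp_mixture mh2.
have ceV : is_cond_exp P G (fun x => (Y x - Z x) ^+ 2) (cond_var P G Y).
  by apply: xgetPex; eexists; exact: ceY2.
have ZE := cond_exp_unique ceZ ceY; have VE := cond_exp_unique ceV ceY2.
by apply: filterS2 ZE VE => t ZE ->; rewrite /h2 ZE.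
Qed.

End finite_mixture.

End cond_exp_theory.

(** * Independent uniforms and measurable thresholds *)

Section uniform_cdf.
Context {R : realType}.

(* The distribution function of the uniform law on [a, b], written so that its
   sum over consecutive strata telescopes. *)
Definition unif_cdf (a b x : R) : R := (Num.min x b - Num.min x a) / (b - a).

Lemma unif_cdf_continuous (a b : R) : continuous (unif_cdf a b).
Proof.
have min_cont c : continuous (fun x : R => Num.min x c).
  by apply: min_fun_continuous => y; [exact: cvg_id|exact: cvg_cst].
move=> x; apply: cvgM; last exact: cvg_cst.
by apply: cvgB; exact: min_cont.
Qed.

Lemma le_unif_cdf (a b x y : R) : a < b -> x <= y -> unif_cdf a b x <= unif_cdf a b y.
Proof.
move=> ab xy; rewrite /unif_cdf ler_pM2r ?invr_gt0 ?subr_gt0//.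
case: (leP x b); case: (leP x a); case: (leP y b); case: (leP y a); lra.
Qed.

Lemma uniform_on_oc d (T : measurableType d) (P : probability T R) (a b x y : R)
    (U : {RV P >-> R}) : uniform_on a b U -> x <= y ->
  P (U @^-1` `]x, y]) = (unif_cdf a b y - unif_cdf a b x)%:E.
Proof.
move=> [ab /(_ _ (measurable_itv `]x, y]))]; rewrite /distribution/= /pushforward => -> xy.
(* The left end stays open at [x] when [a <= x], and becomes the closed end [a] otherwise. *)
have itvE : `]x, y]%classic `&` `[a, b]%classic =
    [set` Interval (if x < a then BLeft a else BRight x) (BRight (Num.min y b))].
  apply/seteqP; split => z /=; rewrite !in_itv/=; case: ifPn => xa /=;
    rewrite le_min; move: xa; rewrite -?leNgt => xa.
  - by move=> [/andP[xz ->] /andP[-> ->]].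
  - by move=> [/andP[-> ->] /andP[_ ->]].
  - by move=> /and3P[az -> ->]; rewrite az (lt_le_trans xa az).
  - by move=> /and3P[xz -> ->]; rewrite xz (le_trans xa (ltW xz)).
rewrite /uniform_prob integral_uniform_pdf itvE.
under eq_integral.
  move=> z; rewrite inE -itvE => -[_ /=]; rewrite in_itv/= => zab.
  rewrite /uniform_pdf zab.
  over.
rewrite integral_cst//= lebesgue_measure_itv/= /unif_cdf -mulrBl.
case: (ltP x a) => xa /=; rewrite lte_fin; case: ltP => h;
  rewrite ?mule0 -?EFinD -?EFinM; congr (_%:E);
  first [rewrite mulrC; congr (_ / _)
        |apply/esym/eqP; rewrite mulf_eq0; apply/orP; left; apply/eqP];
  move: h; case: (leP x b) => ?; case: (leP y b) => ?; case: (leP y a) => ?; lra.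
Qed.

End uniform_cdf.

(** * Rounding up to a grid of mesh [1 / N.+1] *)

Section discretization.
Context {R : realType}.

(* Strictly above [x], so that [u <= grid_up N x] is eventually equivalent to
   [u <= x] even when [u = x]. *)
Definition grid_up (N : nat) (x : R) : R := (Num.truncn (N.+1%:R * x)).+1%:R / N.+1%:R.

Lemma grid_up_gt N x : x < grid_up N x.
Proof. by rewrite /grid_up ltr_pdivlMr// mulrC truncnS_gt. Qed.

Lemma grid_up_le N x : 0 <= x -> grid_up N x <= x + N.+1%:R^-1.
Proof.
move=> x0; rewrite /grid_up ler_pdivrMr// mulrDl mulVf// -natr1 lerD2r mulrC.
by rewrite truncn_le mulr_ge0.
Qed.

Lemma grid_up_nondecreasing N : nondecreasing_fun (grid_up N).
Proof.
move=> x y xy; rewrite /grid_up ler_pM2r ?invr_gt0// ler_nat ltnS.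
by apply: le_truncn; rewrite ler_pM2l.
Qed.

Lemma cvg_grid_up x : 0 <= x -> grid_up N x @[N --> \oo] --> x.
Proof.
move=> x0; apply: (@squeeze_cvgr _ _ _ _ (fun=> x) (fun N => x + N.+1%:R^-1)).
- by apply: nearW => N; rewrite grid_up_le// ltW// grid_up_gt.
- exact: cvg_cst.
- rewrite -[X in _ --> X]addr0; apply: cvgD; first exact: cvg_cst.
  exact: cvg_harmonic.
Qed.

Lemma near_le_grid_up u x : 0 <= x -> \forall N \near \oo, (u <= grid_up N x) = (u <= x).
Proof.
move=> x0; case: (leP u x) => ux.
  by apply: nearW => N; rewrite (le_trans ux)// ltW// grid_up_gt.
near=> N; apply/negbTE; rewrite -ltNge.
by near: N; exact: (cvgr_lt x (cvg_grid_up x0) _ ux).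
Unshelve. all: by end_near. Qed.

End discretization.

(** * Independence extended from fixed sets to windows depending on [G] *)

Section independence.
Context d (T : measurableType d) (R : realType) (P : probability T R).
Context (G : set (set T)) (hG : is_sub_sigma_field G).
Context (n : nat) (U : 'I_n -> {RV P >-> R}) (indU : indep_with G U).

Lemma prod_indicE (B : 'I_n -> set R) (x : T) :
  \prod_k \1_(B k) (U k x) = \1_(\bigcap_(k in [set: 'I_n]) (U k @^-1` B k)) x :> R.
Proof.
have [xB|xB] := pselect ((\bigcap_(k in [set: 'I_n]) (U k @^-1` B k)) x).
  rewrite [RHS]indicE mem_set//= big1// => k _.
  by rewrite indicE mem_set//; exact: xB.
have [k kB] : exists k, ~ B k (U k x).
  by apply: contrapT => h; apply: xB => k _; apply: contrapT => kB; apply: h; exists k.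
by rewrite [RHS]indicE memNset//= (bigD1 k)//= indicE memNset// mul0r.
Qed.

Lemma measurable_bigcap_RV (B : 'I_n -> set R) : (forall k, measurable (B k)) ->
  measurable (\bigcap_(k in [set: 'I_n]) (U k @^-1` B k)).
Proof.
move=> mB; apply: fin_bigcap_measurable; first exact: finite_finset.
by move=> k _; rewrite -[X in measurable X]setTI; exact: measurable_funPT.
Qed.

Lemma measurable_fun_oc (lo hi u : T -> R) : measurable_fun setT lo ->
  measurable_fun setT hi -> measurable_fun setT u ->
  measurable_fun setT (fun x => (lo x < u x <= hi x)%R%:R : R).
Proof.
move=> mlo mhi mu; have -> : (fun x => (lo x < u x <= hi x)%R%:R : R) =
    (fun x => if (lo x < u x) && (u x <= hi x) then 1 else 0).
  by apply/funext => x; case: ifP.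
apply: measurable_fun_ifT => //; apply: measurable_and.
  exact: measurable_fun_ltr.
exact: measurable_fun_ler.
Qed.

(** Freezing: on each of the finitely many level sets of [th], which lie in [G], the sets
    [B k (th x)] are constant and [indU] applies to [A] cut by that level set. *)
Lemma integral_indep_finite (V : finType) (th : T -> V) (B : 'I_n -> V -> set R)
    (A : set T) :
  (forall v, G (th @^-1` [set v])) -> (forall k v, measurable (B k v)) -> G A ->
  (\int[P]_(x in A) (\prod_k \1_(B k (th x)) (U k x))%:E =
   \int[P]_(x in A) (\prod_k fine (P (U k @^-1` B k (th x))))%:E)%E.
Proof.
move=> Gth mB GA; have mA := sub_sigma_field_measurable hG GA.
have mth v : measurable (th @^-1` [set v]).
  by apply: (sub_sigma_field_measurable hG); exact: Gth.
under eq_integral do rewrite (mixture_indicE _ (fun v x => \prod_k \1_(B k v) (U k x)))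
  -sumEFin.
under [RHS]eq_integral do rewrite
  (mixture_indicE _ (fun v x => \prod_k fine (P (U k @^-1` B k v)))) -sumEFin.
have p0 k v : 0 <= fine (P (U k @^-1` B k v)) by rewrite fine_ge0.
have mI v : measurable (\bigcap_(k in [set: 'I_n]) (U k @^-1` B k v)).
  exact: measurable_bigcap_RV.
have indM (X Y : set T) x : \1_X x * \1_Y x = \1_(X `&` Y) x :> R.
  by rewrite indicI.
rewrite !ge0_integral_sum//.
- apply: eq_bigr => v _.
  under eq_integral do rewrite prod_indicE indM.
  rewrite integral_indic//; last exact: measurableI.
  under [RHS]eq_integral do rewrite EFinM.
  rewrite ge0_integralZl//; last by rewrite lee_fin prodr_ge0.
  rewrite integral_indic// -setIA setIC.
  rewrite [LHS](indU (B := fun k => B k v))//; last first.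
    by rewrite -(sub_sigma_fieldE hG); apply: measurableI; rewrite (sub_sigma_fieldE hG).
  rewrite muleC; congr (_ * _)%E; rewrite -prodEFin; apply: eq_bigr => k _.
  rewrite fineK// fin_num_measure//.
    by rewrite -[X in measurable X]setTI; exact: measurable_funPT.
  by apply/measurable_EFinP; exact: measurable_indic.
- by move=> v; apply/measurable_EFinP; apply: measurable_funM.
- by move=> v x _; rewrite lee_fin mulr_ge0// prodr_ge0.
- move=> v; under eq_fun do rewrite prod_indicE.
  by apply/measurable_EFinP; apply: measurable_funM.
- move=> v x _; rewrite lee_fin mulr_ge0//.
  by rewrite prod_indicE.
Qed.

Section thresholds.
Context (lo hi : 'I_n -> T -> R) (F : 'I_n -> R -> R).
Hypothesis mlo : forall k, measurable_wrt G (lo k).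
Hypothesis mhi : forall k, measurable_wrt G (hi k).
Hypothesis lo0 : forall k x, 0 <= lo k x.
Hypothesis lohi : forall k x, lo k x <= hi k x.
Hypothesis hi1 : forall k x, hi k x <= 1.
Hypothesis cF : forall k, continuous (F k).
Hypothesis UF : forall k x y, x <= y ->
  P (U k @^-1` `]x, y]) = (F k y - F k x)%:E.

Lemma indep_oc_prob01 k x y : x <= y -> 0 <= F k y - F k x <= 1.
Proof.
move=> xy; rewrite -!lee_fin -UF// measure_ge0 probability_le1//.
by rewrite -[X in measurable X]setTI; exact: measurable_funPT.
Qed.

Lemma integral_indep_grid (N : nat) (A : set T) : G A ->
  (\int[P]_(x in A)
      (\prod_k (grid_up N (lo k x) < U k x <= grid_up N (hi k x))%R%:R)%:E =
   \int[P]_(x in A)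
      (\prod_k (F k (grid_up N (hi k x)) - F k (grid_up N (lo k x))))%:E)%E.
Proof.
move=> GA.
(* All [2 n] thresholds in one family; the flag is true for upper ends. *)
pose tau (i : 'I_n * bool) x := if i.2 then hi i.1 x else lo i.1 x.
have tau0 i x : 0 <= tau i x.
  by rewrite /tau; case: ifP => // _; rewrite (le_trans (lo0 _ _) (lohi _ _)).
have tau1 i x : tau i x <= 1.
  by rewrite /tau; case: ifP => // _; rewrite (le_trans (lohi _ _)).
have mtau i : measurable_wrt G (tau i).
  by rewrite /tau; case: (i.2); [exact: mhi|exact: mlo].
(* The vector of grid cells of all thresholds. As these lie in [0, 1], the truncations range over
   [0, ..., N.+1]. *)
pose th x : {ffun 'I_n * bool -> 'I_N.+2} :=
  [ffun i => inord (Num.truncn (N.+1%:R * tau i x))].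
have thE i x : (th x i).+1%:R / N.+1%:R = grid_up N (tau i x).
  rewrite /grid_up ffunE inordK// truncn_lt_nat ?mulr_ge0//.
  rewrite (@le_lt_trans _ _ N.+1%:R) ?ltr_nat//.
  by rewrite -[leRHS]mulr1 ler_pM2l ?tau1.
pose B k (v : {ffun 'I_n * bool -> 'I_N.+2}) : set R :=
  `](v (k, false)).+1%:R / N.+1%:R, (v (k, true)).+1%:R / N.+1%:R]%classic.
have Gth v : G (th @^-1` [set v]).
  have -> : th @^-1` [set v] = \bigcap_(i in [set: 'I_n * bool])
      ((grid_up N \o tau i) @^-1` [set (v i).+1%:R / N.+1%:R]).
    apply/seteqP; split => [x <- i _|x h]; first by rewrite /= thE.
    apply/ffunP => i; have /(congr1 ( *%R^~ N.+1%:R)) := h i Logic.I.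
    by rewrite /= -thE !divfK// => /eqP; rewrite eqr_nat eqSS => /eqP/val_inj.
  rewrite -(sub_sigma_fieldE hG); apply: fin_bigcap_measurable.
    exact: finite_finset.
  move=> i _; rewrite -[X in measurable X]setTI.
  have : measurable_wrt G (grid_up N \o tau i).
    apply: measurableT_comp (mtau i).
    apply: nondecreasing_measurable => //; exact: grid_up_nondecreasing.
  by apply => //; exact: measurable_set1.
have mB k v : measurable (B k v) by exact: measurable_itv.
transitivity (\int[P]_(x in A) (\prod_k \1_(B k (th x)) (U k x))%:E)%E.
  apply: eq_integral => x _; congr (_%:E); apply: eq_bigr => k _.
  rewrite indicE /B !thE /tau/=; congr (_%:R); congr nat_of_bool.
  by apply/idP/idP; rewrite inE/= in_itv.
rewrite (integral_indep_finite Gth mB GA); apply: eq_integral => x _; congr (_%:E); apply: eq_bigr => k _.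
by rewrite /B !thE /tau/= UF//; exact: grid_up_nondecreasing.
Qed.

(** The grid identities pass to the limit by dominated convergence, all products lying in [0, 1]:
    the window tests are eventually constant in [N], and the increments converge by continuity of
    [F k]. *)
Lemma integral_indep_thresholds (A : set T) : G A ->
  (\int[P]_(x in A) (\prod_k (lo k x < U k x <= hi k x)%R%:R)%:E =
   \int[P]_(x in A) (\prod_k (F k (hi k x) - F k (lo k x)))%:E)%E.
Proof.
move=> GA; have mA := sub_sigma_field_measurable hG GA.
have hi0 k x : 0 <= hi k x by rewrite (le_trans (lo0 _ _) (lohi _ _)).
have limit (f : nat -> 'I_n -> T -> R) (g : 'I_n -> T -> R) :
    (forall N k, measurable_fun setT (f N k)) ->
    (forall k, measurable_fun setT (g k)) ->
    (forall N k x, 0 <= f N k x <= 1) ->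
    (forall k x, f N k x @[N --> \oo] --> g k x) ->
  (\int[P]_(x in A) (\prod_k f N k x)%:E)%E @[N --> \oo] -->
  (\int[P]_(x in A) (\prod_k g k x)%:E)%E.
  move=> mf mg f01 fg.
  have prod01 N x : 0 <= \prod_k f N k x <= 1.
    rewrite prodr_ge0 => [|k _]; last by case/andP: (f01 N k x).
    by apply: prodr_ile1 => k _; exact: f01.
  have [] // := @dominated_convergence _ _ _ P A mA
    (fun N x => (\prod_k f N k x)%:E) (fun x => (\prod_k g k x)%:E) (cst 1%E).
  - move=> N; apply/measurable_EFinP; apply: measurable_funTS.
    by apply: measurable_prod => k _; exact: mf.
  - apply/measurable_EFinP; apply: measurable_funTS.
    by apply: measurable_prod => k _; exact: mg.
  - apply: aeW => x _; apply: cvg_EFin; first exact: nearW.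
    by apply: cvg_big => [|k _]; [exact: mul_continuous|exact: fg].
  - exact: finite_measure_integrable_cst.
  - apply: aeW => x N _ /=; have /andP[p0 p1] := prod01 N x.
    by rewrite lee_fin ger0_norm.
have mF k : measurable_fun setT (F k) by exact: continuous_measurable_fun.
have mgrid N : measurable_fun setT (@grid_up R N).
  by apply: nondecreasing_measurable => //; exact: grid_up_nondecreasing.
have mlo' k := measurable_wrtW hG (mlo k); have mhi' k := measurable_wrtW hG (mhi k).
have grid_lohi N k x : grid_up N (lo k x) <= grid_up N (hi k x).
  exact: grid_up_nondecreasing.
have cvgF k (u : T -> R) x : 0 <= u x ->
    F k (grid_up N (u x)) @[N --> \oo] --> F k (u x).
  by move=> u0; apply: continuous_cvg (cvg_grid_up u0); exact: cF.
have cvgL := limit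
  (fun N k x => (grid_up N (lo k x) < U k x <= grid_up N (hi k x))%R%:R)
  (fun k x => (lo k x < U k x <= hi k x)%R%:R).
have cvgR := limit
  (fun N k x => F k (grid_up N (hi k x)) - F k (grid_up N (lo k x)))
  (fun k x => F k (hi k x) - F k (lo k x)).
rewrite -(cvg_lim _ (cvgL _ _ _ _))//; last 4 first.
- move=> N k; apply: measurable_fun_oc => //.
    exact: measurableT_comp.
  exact: measurableT_comp.
- by move=> k; apply: measurable_fun_oc.
- by move=> N k x; case: (_ < _ <= _)%R; rewrite ?lexx ?ler01.
- move=> k x; apply: cvg_near_cst; near=> N.
  have -> : (grid_up N (lo k x) < U k x) = (lo k x < U k x).
    rewrite !ltNge; congr (~~ _).
    by near: N; exact: near_le_grid_up.
  suff -> : (U k x <= grid_up N (hi k x)) = (U k x <= hi k x) by [].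
  by near: N; exact: near_le_grid_up.
rewrite -(cvg_lim _ (cvgR _ _ _ _))//; last 4 first.
- by move=> N k; apply: measurable_funB; apply: measurableT_comp (mF k) _;
    apply: measurableT_comp.
- by move=> k; apply: measurable_funB; exact: measurableT_comp.
- by move=> N k x; exact: indep_oc_prob01.
- by move=> k x; apply: cvgB; exact: cvgF.
by under eq_fun do rewrite integral_indep_grid//.
Unshelve. all: by end_near. Qed.

End thresholds.

End independence.

(** * Resampling *)

Section cumulative_weights.
Context {R : realType} (m : nat) (m_gt0 : (0 < m)%N).
Implicit Types (w : 'I_m -> R) (i : 'I_m).

(* [cum w i] and [cum w i.+1] are, up to conversion, the two sums tested by [Dinv]. *)
Definition cum w (j : nat) : R := \sum_(l < m | (l < j)%N) w l.

Section weights.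
Variables (w : 'I_m -> R) (w_ge0 : forall i, 0 <= w i).
Hypothesis w_sum1 : \sum_(i < m) w i = 1.

Lemma cum0 : cum w 0 = 0. Proof. exact: big_pred0. Qed.

Lemma cum_size : cum w m = 1.
Proof. by rewrite -w_sum1; apply: eq_bigl => i; rewrite ltn_ord. Qed.

Lemma cumS i : cum w i.+1 = cum w i + w i.
Proof.
rewrite /cum (bigD1 i)//= addrC; congr (_ + _); apply: eq_bigl => l.
by rewrite ltnS -val_eqE/= leq_eqVlt; case: ltngtP.
Qed.

Lemma cum_ge0 j : 0 <= cum w j.
Proof. by apply: sumr_ge0 => l _. Qed.

Lemma le_cum j k : (j <= k)%N -> cum w j <= cum w k.
Proof.
move=> jk; rewrite /cum [leRHS](bigID (fun l : 'I_m => (l < j)%N))/=.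
rewrite [X in _ <= X + _](eq_bigl (fun l : 'I_m => (l < j)%N)); last first.
  by move=> l; case: (ltnP l j) => lj; rewrite ?andbF// (leq_trans lj jk).
by rewrite lerDl sumr_ge0.
Qed.

Lemma cum_le1 j : cum w j <= 1.
Proof.
rewrite -w_sum1 /cum [leRHS](bigID (fun l : 'I_m => (l < j)%N))/=.
by rewrite lerDl sumr_ge0.
Qed.

(** For [F] a uniform distribution function, this computes the total mass of the conditional law of
    an index. *)
Lemma sum_cum_increments (F : R -> R) :
  \sum_(i < m) (F (cum w i.+1) - F (cum w i)) = F 1 - F 0.
Proof.
rewrite -[X in _ - F X]cum0 -[X in F X - _]cum_size.
rewrite -(big_mkord xpredT (fun j => F (cum w j.+1) - F (cum w j))).
exact: (telescope_sumr (fun j => F (cum w j))).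
Qed.

Lemma Dinv_unique u i : cum w i < u <= cum w i.+1 -> Dinv m_gt0 w u = i.
Proof.
move=> /andP[iu ui]; rewrite /Dinv; case: pickP => [l|/(_ i)]; last first.
  by rewrite -/(cum w i) -/(cum w i.+1) iu ui.
rewrite -/(cum w l) -/(cum w l.+1) => /andP[lu ul]; apply/val_inj => /=.
apply/eqP; rewrite eqn_leq; apply/andP; split; rewrite leqNgt; apply/negP => h.
  by have := lt_le_trans lu (le_trans ui (le_cum h)); rewrite ltxx.
by have := lt_le_trans iu (le_trans ul (le_cum h)); rewrite ltxx.
Qed.

Lemma Dinv_exists u : 0 < u <= 1 -> exists i, cum w i < u <= cum w i.+1.
Proof.
(* The index is the predecessor of the least [j] with [u <= cum w j]; [j = 0] is excluded by
   [0 < u]. *)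
move=> /andP[u0 u1].
have ex : exists j, u <= cum w j by exists m; rewrite cum_size.
case: (ex_minnP ex) => -[|j] uj jmin.
  by move: uj; rewrite cum0 leNgt u0.
have jm : (j < m)%N by apply: jmin; rewrite cum_size.
exists (Ordinal jm) => /=; rewrite uj andbT ltNge; apply/negP => /jmin.
by rewrite ltnn.
Qed.

Lemma DinvE u i : 0 < u <= 1 ->
  (Dinv m_gt0 w u == i) = (cum w i < u <= cum w i.+1).
Proof.
move=> u01; apply/eqP/idP => [<-|]; last exact: Dinv_unique.
by have [l lP] := Dinv_exists u01; rewrite (Dinv_unique lP).
Qed.

End weights.
End cumulative_weights.

(** * Resampling with independent uniforms on arbitrary subintervals of the unit interval *)

Section resampling.
Context d (T : measurableType d) (R : realType) (P : probability T R).
Context (G : set (set T)) (hG : is_sub_sigma_field G).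
Context (X : Type) (m n : nat) (m_gt0 : (0 < m)%N).
Context (xi : 'I_m -> T -> X) (w : 'I_m -> T -> R) (f : X -> R).
Hypothesis mxi : forall i, measurable_wrt G (f \o xi i).
Hypothesis mw : forall i, measurable_wrt G (w i).
Hypothesis w_ge0 : forall i t, 0 <= w i t.
Hypothesis w_sum1 : forall t, \sum_(i < m) w i t = 1.
Context (a b : 'I_n -> R) (U : 'I_n -> {RV P >-> R}).
Hypothesis indU : indep_with G U.
Hypothesis uU : forall k, uniform_on (a k) (b k) (U k).
Hypothesis ab01 : forall k, [/\ 0 <= a k, a k < b k & b k <= 1].

(** The conditional probability given [G] that the [k]-th sample index is [i]. *)
Let p (k : 'I_n) (i : 'I_m) (t : T) : R :=
  unif_cdf (a k) (b k) (cum (w^~ t) i.+1) - unif_cdf (a k) (b k) (cum (w^~ t) i).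

(** All sample indices gathered in one finite-valued variable, which serves as the index of a finite
    mixture. *)
Let J (t : T) : {ffun 'I_n -> 'I_m} := [ffun k => Dinv m_gt0 (w^~ t) (U k t)].

Lemma unif_cdf01 (x y : R) : 0 <= x -> x < y -> y <= 1 ->
  unif_cdf x y 1 - unif_cdf x y 0 = 1.
Proof.
move=> x0 xy y1; rewrite /unif_cdf min_r// min_r ?(ltW (lt_le_trans xy y1))//.
rewrite min_l ?(le_trans x0 (ltW xy))// min_l// subrr mul0r subr0 divff//.
by rewrite subr_eq0 gt_eqF.
Qed.

Lemma measurable_wrt_cum j : measurable_wrt G (fun t => cum (w^~ t) j).
Proof.
rewrite /measurable_wrt /cum; under eq_fun do rewrite big_mkcond.
by apply: measurable_sum => l; case: (l < j)%N; [exact: mw|exact: measurable_cst].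
Qed.

Lemma measurable_Dinv (u : T -> R) (i : 'I_m) : measurable_fun setT u ->
  measurable [set t | Dinv m_gt0 (w^~ t) (u t) = i].
Proof.
move=> mu.
pose E l := [set t | cum (w^~ t) l < u t <= cum (w^~ t) l.+1].
have mE l : measurable (E l).
  have mc j := measurable_wrtW hG (measurable_wrt_cum j).
  have mb := measurable_and (measurable_fun_ltr (mc l) mu)
    (measurable_fun_ler mu (mc l.+1)).
  by have := mb measurableT [set true] Logic.I; rewrite setTI.
(* The first index also collects the points where no window contains [u t], since it is the default
   of [Dinv]. *)
have -> : [set t | Dinv m_gt0 (w^~ t) (u t) = i] =
    E i `|` (if i == Ordinal m_gt0
      then \bigcap_(l in [set: 'I_m]) ~` E l else set0).
  apply/seteqP; split => t /=.
    rewrite /Dinv; case: pickP => [l lP <-|noE <-]; first by left.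
    by right; rewrite eqxx => l _; rewrite /E /= [cum _ _ < _ <= _]noE.
  case=> [|]; first exact: Dinv_unique.
  case: eqP => // -> noE; rewrite /Dinv; case: pickP => // l lP.
  by have := noE l Logic.I.
apply: measurableU => //; case: ifP => // _.
by apply: fin_bigcap_measurable => [|l _]; [exact: finite_finset|exact: measurableC].
Qed.

Lemma measurable_indices s : measurable (J @^-1` [set s]).
Proof.
have -> : J @^-1` [set s] =
    \bigcap_(k in [set: 'I_n]) [set t | Dinv m_gt0 (w^~ t) (U k t) = s k].
  apply/seteqP; split => [t <- k _|t h]; first by rewrite /= ffunE.
  by apply/ffunP => k; rewrite ffunE; exact: h.
apply: fin_bigcap_measurable => [|k _]; first exact: finite_finset.
exact: measurable_Dinv.
Qed.

(** Discards the event on which [Dinv] may return its default: each []a k, b k]] lies in []0, 1]],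
    which thus has full mass. *)
Lemma ae_uniforms01 : {ae P, forall t, forall k, 0 < U k t <= 1}.
Proof.
apply: filter_forall => k; exists (~` (U k @^-1` `]0, 1])); split.
- apply: measurableC; rewrite -[X in measurable X]setTI.
  exact: measurable_funPT.
- have mU : measurable (U k @^-1` `]0, 1]).
    by rewrite -[X in measurable X]setTI; exact: measurable_funPT.
  have [a0 ab b1] := ab01 k.
  rewrite probability_setC// (uniform_on_oc (uU k))// unif_cdf01//.
  by rewrite subee.
- by move=> t /= h; apply: contra_not h; rewrite in_itv.
Qed.

Lemma p_ge0 k i t : 0 <= p k i t.
Proof.
have [_ ab _] := ab01 k.
by rewrite subr_ge0 le_unif_cdf// le_cum.
Qed.

Lemma measurable_wrt_p k i : measurable_wrt G (p k i).
Proof.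
have mF : measurable_fun setT (unif_cdf (a k) (b k)).
  by apply: continuous_measurable_fun; exact: unif_cdf_continuous.
by apply: measurable_funB; apply: measurableT_comp mF _; exact: measurable_wrt_cum.
Qed.

(** Almost surely [J] equals [s] exactly when each [U k] lies in the window of [s k], whose ends are
    [G]-measurable partial sums; so the conditional law of [J] is the product of the [p k]. *)
Lemma prob_indices (s : {ffun 'I_n -> 'I_m}) (A : set T) : G A ->
  (P (A `&` J @^-1` [set s]) = \int[P]_(x in A) (\prod_k p k (s k) x)%:E)%E.
Proof.
move=> GA; have mA := sub_sigma_field_measurable hG GA.
rewrite setIC -integral_indic//; last exact: measurable_indices.
rewrite -(integral_indep_thresholds hG indU (F := fun k => unif_cdf (a k) (b k))
  (lo := fun k t => cum (w^~ t) (s k)) (hi := fun k t => cum (w^~ t) (s k).+1))//.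
- apply: ae_eq_integral => //.
  + apply/measurable_EFinP/measurable_indic; exact: measurable_indices.
  + apply/measurable_EFinP; apply: measurable_prod => k _.
    apply: measurable_funTS; apply: measurable_fun_oc => //.
      exact: (measurable_wrtW hG (measurable_wrt_cum _)).
    exact: (measurable_wrtW hG (measurable_wrt_cum _)).
  apply: filterS ae_uniforms01 => t U01 _ /=; congr (_%:E).
  rewrite indicE; case: (pselect (J t = s)) => [Js|Js].
    rewrite mem_set// big1// => k _.
    by rewrite -(DinvE m_gt0) // -Js ffunE eqxx.
  rewrite memNset//; have [k kJ] : exists k, J t k != s k.
    apply: contrapT => h; apply: Js; apply/ffunP => k; apply/eqP.
    by apply: contrapT => /negP kJ; apply: h; exists k.
  rewrite (bigD1 k)//= -(DinvE m_gt0)//.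
  by move: kJ; rewrite ffunE => /negbTE ->; rewrite mul0r.
- by move=> k; exact: measurable_wrt_cum.
- by move=> k; exact: measurable_wrt_cum.
- by move=> k x; exact: cum_ge0.
- by move=> k x; exact: le_cum.
- by move=> k x; exact: cum_le1.
- by move=> k; exact: unif_cdf_continuous.
- by move=> k x y; exact: uniform_on_oc.
Qed.

(** The sample mean is a mixture selected by [J], so the mixture formula reduces its conditional
    variance, pointwise in [t], to the variance of a sum under a product law. *)
Lemma ae_cond_var_resample : (0 < n)%N ->
  {ae P, forall t,
    cond_var P G (sample_mean f (resample m_gt0 xi w (fun k => U k))) t =
    n%:R^-1 ^+ 2 * \sum_k (\sum_i p k i t * f (xi i t) ^+ 2 -
                            (\sum_i p k i t * f (xi i t)) ^+ 2)}.
Proof.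
move=> n_gt0.
pose h (s : {ffun 'I_n -> 'I_m}) t := n%:R^-1 * \sum_k f (xi (s k) t).
have mh s : measurable_wrt G (h s).
  apply: measurable_funM; first exact: measurable_cst.
  by apply: measurable_sum => k; exact: (mxi (s k)).
have mq (s : {ffun 'I_n -> 'I_m}) : measurable_wrt G (fun t => \prod_k p k (s k) t).
  by apply: measurable_prod => k _; exact: measurable_wrt_p.
have q0 (s : {ffun 'I_n -> 'I_m}) t : 0 <= \prod_k p k (s k) t.
  by apply: prodr_ge0 => k _; exact: p_ge0.
have := cond_var_mixture hG measurable_indices mq q0 prob_indices mh.
have -> : (fun t => h (J t) t) = sample_mean f (resample m_gt0 xi w (fun k => U k)).
  by apply/funext => t; congr (_ * _); apply: eq_bigr => k _; rewrite ffunE.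
apply: filterS => t ->.
have p1 k : \sum_i p k i t = 1.
  have [a0 ab b1] := ab01 k.
  by rewrite sum_cum_increments// unif_cdf01.
rewrite -(variance_sum_prod_weights (fun k i => f (xi i t)) p1).
have -> : \sum_r h r t * \prod_k p k (r k) t =
    n%:R^-1 * \sum_k \sum_i p k i t * f (xi i t).
  rewrite -(mean_sum_prod_weights (fun k i => f (xi i t)) p1) mulr_sumr.
  by apply: eq_bigr => s _; rewrite /h -mulrA [X in _ * X]mulrC.
rewrite [RHS]mulr_sumr; apply: eq_bigr => s _.
by rewrite /h -mulrBr exprMn -mulrA [X in _ * X]mulrC.
Qed.

End resampling.

(** * Comparison of the two resampling schemes *)

Theorem mainTheorem2 (d : measure_display) (T : measurableType d) (R : realType)
    (P : probability T R) (G : set (set T)) (X : Type)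
    (m n : nat) (m_gt0 : (0 < m)%N) (n_gt0 : (0 < n)%N)
    (xi : 'I_m -> T -> X) (w : 'I_m -> T -> R) (f : X -> R)
    (Umult Ustrat : 'I_n -> {RV P >-> R}) :
  is_sub_sigma_field G ->
  (forall i, measurable_wrt G (f \o xi i)) ->
  (forall i, measurable_wrt G (w i)) ->
  (forall i t, 0 <= w i t) ->
  (forall t, \sum_(i < m) w i t = 1) ->
  multinomial_uniforms G Umult ->
  stratified_uniforms G Ustrat ->
  {ae P, forall t,
    cond_var P G (sample_mean f (resample m_gt0 xi w (fun i => Ustrat i))) t
    <= cond_var P G (sample_mean f (resample m_gt0 xi w (fun i => Umult i))) t}.
Proof.
move=> hG mxi mw w0 w1 [iM uM] [iS uS].
have n0 : 0 < n%:R :> R by rewrite ltr0n.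
(* Both schemes are instances of the general setting: the unit interval for every [k], or the [k]-th
   of [n] equal strata, counted from 0. *)
have abM (k : 'I_n) : [/\ 0 <= 0 :> R, 0 < 1 :> R & 1 <= 1 :> R] by [].
have abS (k : 'I_n) : [/\ 0 <= k%:R / n%:R :> R, k%:R / n%:R < k.+1%:R / n%:R :> R
    & k.+1%:R / n%:R <= 1 :> R].
  split; first by rewrite divr_ge0.
    by rewrite ltr_pM2r ?invr_gt0// ltr_nat.
  by rewrite ler_pdivrMr// mul1r ler_nat.
have VM := ae_cond_var_resample hG m_gt0 mxi mw w0 w1 iM uM abM n_gt0.
have VS := ae_cond_var_resample hG m_gt0 mxi mw w0 w1 iS uS abS n_gt0.
apply: filterS2 VM VS => t -> ->.
rewrite ler_pM2l ?exprn_gt0 ?invr_gt0//.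
(* On [0, 1] the distribution function of the unit uniform is the identity, so the multinomial law
   is [w] itself. *)
have cumE (i : 'I_m) : unif_cdf 0 1 (cum (w^~ t) i.+1) - unif_cdf 0 1 (cum (w^~ t) i)
    = w i t.
  have c01 j : unif_cdf 0 1 (cum (w^~ t) j) = cum (w^~ t) j.
    rewrite /unif_cdf min_l ?cum_le1// min_r ?cum_ge0//.
    by rewrite !subr0 divr1.
  by rewrite !c01 cumS addrAC subrr add0r.
rewrite [leRHS](eq_bigr (fun=> \sum_i w i t * f (xi i t) ^+ 2 -
    (\sum_i w i t * f (xi i t)) ^+ 2)); last first.
  by move=> k _; under eq_bigr do rewrite cumE;
    under [X in _ - X ^+ 2]eq_bigr do rewrite cumE.
apply: (le_variance_averaged_weights (w := w^~ t) (fun i => f (xi i t))) => // i.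
(* The strata average to the unit uniform: their distribution functions telescope, with the factor
   [n] coming from the width [1 / n]. Increments then give the averaging condition on the laws. *)
have sumE (x : R) : 0 <= x <= 1 ->
  \sum_(k < n) unif_cdf (k%:R / n%:R) (k.+1%:R / n%:R) x = n%:R * x.
  move=> /andP[x0 x1]; pose g k : R := Num.min x (k%:R / n%:R).
  rewrite (eq_bigr (fun k : 'I_n => n%:R * (g k.+1 - g k))) => [|k _].
    rewrite -mulr_sumr -(big_mkord xpredT (fun k => g k.+1 - g k)).
    rewrite telescope_sumr// /g divff ?gt_eqF// mul0r min_l// min_r//.
    by rewrite subr0.
  rewrite /unif_cdf -mulrBl -natrB// subSnn div1r invrK mulrC.
  by [].
by rewrite sumrB !sumE ?cum_ge0 ?cum_le1// -mulrBr cumS addrAC subrr add0r.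
Qed.
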